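(* Let $f,g:U\subset\mathbb{R}^2\to\mathbb{R}$ be smooth functions on an open set $U$ such that the graph $$M=\{(x,y,f(x,y),g(x,y))\in\mathbb{R}^{3,1}\mid (x,y)\in U\}$$ is a spacelike surface. Then $M$ has a canonical normal null direction with respect to $e_1=(1,0,0,0)$ if and only if $$(1+f_y^2)g_x^2-2f_xf_yg_xg_y-(1-g_y^2)f_x^2=0\quad\text{on }U.$$
   Context: $\mathbb{R}^{3,1}$ is $\mathbb{R}^4$ with the metric $\langle\cdot,\cdot\rangle=dx_1^2+dx_2^2+dx_3^2-dx_4^2$. A surface is spacelike if its induced metric is Riemannian. $e_1=e_1^\top+e_1^\perp$ is the decomposition of the constant vector field $e_1$ into tangent and normal parts along $M$; $M$ has a canonical normal null direction with respect to $e_1$ if $e_1^\perp$ is a lightlike normal vector field along $M$ (nonzero with $\langle e_1^\perp,e_1^\perp\rangle=0$).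
   Formalization: The formal theorem adds the assumption that e_1 is nowhere tangent to M (equivalently e_1^⊥ is nowhere zero); without it the claim fails, e.g. for f = g = 0, where the equation holds but e_1^⊥ = 0 is not lightlike. *)

(* Defs.v *)
From HB Require Import structures.
From mathcomp Require Import all_boot all_order all_algebra.
From mathcomp Require Import all_classical all_reals all_analysis.
Set Implicit Arguments.
Unset Strict Implicit.
Unset Printing Implicit Defensive.
Import Order.TTheory GRing.Theory Num.Theory.
Import numFieldNormedType.Exports.
Local Open Scope classical_set_scope.
Local Open Scope ring_scope.

Definition partial (R : realType) (i : 'I_2) (f : 'rV[R]_2 -> R) :
    'rV[R]_2 -> R :=
  'D_(delta_mx 0 i) f.

(* C^oo on U: every iterated partial derivative is Frechet differentiable at
   each point of U.  For open U this depends only on the restriction of f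
   to U, although f is a total function. *)
Definition smooth_on (R : realType) (U : set 'rV[R]_2) (f : 'rV[R]_2 -> R) :
    Prop :=
  forall (s : seq 'I_2) (p : 'rV[R]_2),
    U p -> differentiable (foldr (@partial R) f s) p.

(* R^{3,1} is 'rV[R]_4; the last coordinate is the timelike one. *)
Definition mink (R : realType) (u v : 'rV[R]_4) : R :=
  \sum_(i < 4 | i != ord_max) u 0 i * v 0 i - u 0 ord_max * v 0 ord_max.

Definition e1 (R : realType) : 'rV[R]_4 := delta_mx 0 ord0.

(* A surface is given by a parametrization phi of it over U; vector fields
   along the surface are functions of the parameter. *)
Definition tangent_space (R : realType) (phi : 'rV[R]_2 -> 'rV[R]_4)
    (p : 'rV[R]_2) : set 'rV[R]_4 :=
  range ('d phi p).

Definition induced_metric (R : realType) (phi : 'rV[R]_2 -> 'rV[R]_4)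
    (p u v : 'rV[R]_2) : R :=
  mink ('d phi p u) ('d phi p v).

Definition spacelike (R : realType) (U : set 'rV[R]_2)
    (phi : 'rV[R]_2 -> 'rV[R]_4) : Prop :=
  forall p : 'rV[R]_2, U p ->
  forall v : 'rV[R]_2, v != 0 -> 0 < induced_metric phi p v v.

Definition normal_space (R : realType) (phi : 'rV[R]_2 -> 'rV[R]_4)
    (p : 'rV[R]_2) : set 'rV[R]_4 :=
  [set w | forall t, tangent_space phi p t -> mink w t = 0].

(* The normal part of z at phi p: the w such that z = (z - w) + w splits z
   into a tangent and a normal vector.  It exists and is unique where the
   surface is spacelike; the default value 0 is irrelevant there. *)
Definition normal_part (R : realType) (phi : 'rV[R]_2 -> 'rV[R]_4)
    (z : 'rV[R]_4) (p : 'rV[R]_2) : 'rV[R]_4 :=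
  xget 0 [set w | tangent_space phi p (z - w) /\ normal_space phi p w].

Definition lightlike (R : realType) (v : 'rV[R]_4) : Prop :=
  v != 0 /\ mink v v = 0.

Definition canonical_normal_null_direction (R : realType) (U : set 'rV[R]_2)
    (phi : 'rV[R]_2 -> 'rV[R]_4) (z : 'rV[R]_4) : Prop :=
  forall p : 'rV[R]_2, U p -> lightlike (normal_part phi z p).

Definition graph_param (R : realType) (f g : 'rV[R]_2 -> R)
    (p : 'rV[R]_2) : 'rV[R]_4 :=
  \row_(i < 4) [:: p 0 0; p 0 1; f p; g p]`_i.

(* Main.v *)
Require Import Defs.
From HB Require Import structures.
From mathcomp Require Import all_boot all_order all_algebra.
From mathcomp Require Import all_classical all_reals all_analysis.
From mathcomp Require Import ring.
Import Order.TTheory GRing.Theory Num.Theory.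
Import numFieldNormedType.Exports.
Local Open Scope classical_set_scope.
Local Open Scope ring_scope.

(** At a point of the graph write E, F, G for the coefficients of the first
fundamental form in the frame X = (1, 0, f_x, g_x), Y = (0, 1, f_y, g_y), and
D = E G - F^2, which is positive because the surface is spacelike.  Positivity
of D makes the normal equations for the tangent part a X + b Y of e_1
solvable.  They read a E + b F = <e_1, X> = 1 and a F + b G = <e_1, Y> = 0, so
D a = G.

The normal part w of e_1 satisfies <w, w> = <e_1, w> = 1 - a
([mink_normal_self]), hence D <w, w> = D - G = (E - 1) G - F^2, and this
polynomial in the partial derivatives is exactly the opposite of the left-hand
side of the differential equation ([mink_normal_part_graph]).  As D > 0, the
equation at a point says that w is null there.  It says nothing about w being
nonzero: a zero normal part means that e_1 is tangent, which is the case
excluded by hypothesis. *)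

(** * Vectors of R^{3,1} in coordinates *)

Definition row4 {R : realType} (a b c d : R) : 'rV[R]_4 :=
  \row_(i < 4) [:: a; b; c; d]`_i.

Lemma e1E (R : realType) : e1 R = row4 1 0 0 0.
Proof.
by apply/rowP => -[[|[|[|[|//]]]] lt_i4]; rewrite !mxE.
Qed.

Lemma mink_row4 (R : realType) (a b c d a' b' c' d' : R) :
  mink (row4 a b c d) (row4 a' b' c' d') =
    a * a' + b * b' + c * c' - d * d'.
Proof.
by rewrite /mink big_mkcond !big_ord_recr big_ord0 !mxE /= add0r addr0.
Qed.

Lemma minkC (R : realType) (u v : 'rV[R]_4) : mink u v = mink v u.
Proof.
rewrite /mink mulrC; congr (_ - _).
by apply: eq_bigr => i _; rewrite mulrC.
Qed.

Lemma minkBl (R : realType) (u v w : 'rV[R]_4) :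
  mink (u - v) w = mink u w - mink v w.
Proof.
rewrite /mink !mxE mulrBl.
under eq_bigr => i _ do rewrite !mxE mulrBl.
by rewrite sumrB; ring.
Qed.

(** The defect <z, w> - <w, w> = <z - w, w> pairs a tangent with a normal
vector.  This makes the norm of the normal part linear in the coefficients of
the tangent part. *)
Lemma mink_normal_self (R : realType) (phi : 'rV[R]_2 -> 'rV[R]_4)
    (p : 'rV[R]_2) (z w : 'rV[R]_4) :
  tangent_space phi p (z - w) -> Defs.normal_space phi p w ->
  mink w w = mink z w.
Proof.
move=> tan_zw nor_w; apply/eqP; rewrite eq_sym -subr_eq0 -minkBl minkC.
by rewrite nor_w.
Qed.

(** * The differential of a graph *)

(** A row-valued map is the sum of its components, each followed by the linear
map t |-> t e_i, so the chain rule and additivity suffice. *)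
Lemma is_diff_row (R : realType) (V : normedModType R) (n : nat)
    (phi dphi : V -> 'rV[R]_n) (p : V) :
  (forall i, is_diff p (fun q => phi q 0 i) (fun v => dphi v 0 i)) ->
  is_diff p phi dphi.
Proof.
move=> dphiP.
have rowE (h : V -> 'rV[R]_n) :
    h = \sum_i (( *:%R^~ (delta_mx 0 i)) \o (fun q => h q 0 i)).
  apply/funext => q; rewrite fct_sumE.
  by rewrite [LHS]row_sum_delta.
rewrite (rowE phi) (rowE dphi).
apply: (big_ind2 (fun u v : V -> 'rV[R]_n => is_diff p u v)).
- exact: is_diff_cst.
- by move=> *; apply: is_diffD.
- by move=> i _; apply: is_diff_comp.
Qed.

Lemma is_diff_coord (R : realType) (m n : nat) (i : 'I_m) (j : 'I_n)
    (M : 'M[R]_(m, n)) :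
  is_diff M (fun N : 'M[R]_(m, n) => N i j : R) (fun N => N i j).
Proof.
have coord_linear : linear (fun N : 'M[R]_(m, n) => N i j : R).
  by move=> a x y; rewrite !mxE.
pose L : {linear 'M[R]_(m, n) -> R} :=
  HB.pack (fun N : 'M[R]_(m, n) => N i j : R)
    (GRing.isLinear.Build R _ _ _ _ coord_linear).
apply: DiffDef; first exact: differentiable_coord.
by rewrite (@diff_lin _ _ _ L) //; exact: coord_continuous.
Qed.

Lemma diff_partial (R : realType) (f : 'rV[R]_2 -> R) (p v : 'rV[R]_2) :
  differentiable f p ->
  'd f p v = v 0 0 * partial 0 f p + v 0 1 * partial 1 f p.
Proof.
move=> df; rewrite /partial !deriveE // {1}[v]row_sum_delta.
rewrite linear_sum !big_ord_recl big_ord0 addr0 !linearZ /=.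
by congr (_ * _ + v 0 _ * 'd f p (delta_mx 0 _)); apply/val_inj.
Qed.

Lemma diff_graph_param (R : realType) (f g : 'rV[R]_2 -> R)
    (p v : 'rV[R]_2) :
  differentiable f p -> differentiable g p ->
  'd (graph_param f g) p v =
    row4 (v 0 0) (v 0 1)
      (v 0 0 * partial 0 f p + v 0 1 * partial 1 f p)
      (v 0 0 * partial 0 g p + v 0 1 * partial 1 g p).
Proof.
move=> df dg.
apply: (@etrans _ _ (row4 (v 0 0) (v 0 1) ('d f p v) ('d g p v)));
  last by rewrite !diff_partial.
pose dphi (u : 'rV[R]_2) := row4 (u 0 0) (u 0 1) ('d f p u) ('d g p u).
suff dphiP : is_diff p (graph_param f g) dphi
  by rewrite (@diff_val _ _ _ _ _ _ _ dphiP).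
(* The four components are the two coordinates, f and g. *)
apply: is_diff_row => -[[|[|[|[|//]]]] lt_i4].
- have -> : (fun q => graph_param f g q 0 (Ordinal lt_i4)) = (fun q => q 0 0).
    by apply/funext => q; rewrite mxE.
  apply: is_diff_eq (is_diff_coord _ _ _ _ _ _) _.
  by apply/funext => u; rewrite mxE.
- have -> : (fun q => graph_param f g q 0 (Ordinal lt_i4)) = (fun q => q 0 1).
    by apply/funext => q; rewrite mxE.
  apply: is_diff_eq (is_diff_coord _ _ _ _ _ _) _.
  by apply/funext => u; rewrite mxE.
- have -> : (fun q => graph_param f g q 0 (Ordinal lt_i4)) = f.
    by apply/funext => q; rewrite mxE.
  by apply: is_diff_eq (differentiableP df) _; apply/funext => u; rewrite mxE.
- have -> : (fun q => graph_param f g q 0 (Ordinal lt_i4)) = g.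
    by apply/funext => q; rewrite mxE.
  by apply: is_diff_eq (differentiableP dg) _; apply/funext => u; rewrite mxE.
Qed.

(** * The normal part of e1 along a spacelike graph *)

(** The form is evaluated at (0, 1) and at (c, - b), a vector orthogonal to
(0, 1) for this form, where its value is c (a c - b^2). *)
Lemma gram_gt0 (R : realType) (a b c : R) :
  (forall x y : R, (x, y) != (0, 0) ->
     0 < a * x ^+ 2 + 2 * b * x * y + c * y ^+ 2) ->
  0 < a * c - b ^+ 2.
Proof.
move=> pos.
have c_gt0 : 0 < c.
  have /pos : ((0, 1) : R * R) != (0, 0).
    by rewrite xpair_eqE oner_eq0 andbF.
  by rewrite expr0n mulr0 mulr0 mul0r expr1n mulr1 !add0r.
have /pos : (c, - b) != (0, 0) by rewrite xpair_eqE gt_eqF.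
rewrite (_ : _ + _ = c * (a * c - b ^+ 2)); last by ring.
by rewrite pmulr_rgt0.
Qed.

(** The determinant E G - F^2 of the induced metric of a graph. *)
Definition det_gram (R : realType) (fx fy gx gy : R) : R :=
  (1 + fx ^+ 2 - gx ^+ 2) * (1 + fy ^+ 2 - gy ^+ 2)
    - (fx * fy - gx * gy) ^+ 2.

Section GraphAt.
Variables (R : realType) (f g : 'rV[R]_2 -> R) (p : 'rV[R]_2).
Hypothesis f_diff : differentiable f p.
Hypothesis g_diff : differentiable g p.
Hypothesis metric_gt0 :
  forall v, v != 0 -> 0 < induced_metric (graph_param f g) p v v.

Local Notation phi := (graph_param f g).
Local Notation fx := (partial 0 f p).
Local Notation fy := (partial 1 f p).
Local Notation gx := (partial 0 g p).
Local Notation gy := (partial 1 g p).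

Let tangent_vec (x y : R) :=
  row4 x y (x * fx + y * fy) (x * gx + y * gy).

Lemma tangent_graphP t :
  tangent_space phi p t <-> exists x y, t = tangent_vec x y.
Proof.
split=> [[v _ <-]|[x [y ->]]].
  by exists (v 0 0), (v 0 1); rewrite diff_graph_param.
exists (\row_(i < 2) [:: x; y]`_i) => //.
by rewrite diff_graph_param // !mxE.
Qed.

Lemma graph_gram_gt0 : 0 < det_gram R fx fy gx gy.
Proof.
apply: gram_gt0 => x y xy_neq0.
have v_neq0 : \row_(i < 2) [:: x; y]`_i != 0.
  apply: contra xy_neq0 => /eqP/rowP v0.
  by have := (v0 0, v0 1); rewrite !mxE /= => -[-> ->].
have := metric_gt0 _ v_neq0.
rewrite /induced_metric !diff_graph_param // !mxE /= mink_row4.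
by congr (0 < _); ring.
Qed.

(** The normal part is defined by choice with default value 0, so the
orthogonal decomposition has to be exhibited once; every later fact about it
follows from these two defining properties. *)
Lemma normal_part_graph :
  tangent_space phi p (e1 R - normal_part phi (e1 R) p) /\
  Defs.normal_space phi p (normal_part phi (e1 R) p).
Proof.
apply: (@xgetPex _ 0 [set w | tangent_space phi p (e1 R - w) /\
  Defs.normal_space phi p w]).
have D_gt0 := graph_gram_gt0.
set D := det_gram R _ _ _ _ in D_gt0.
(* Cramer's rule for a E + b F = 1, a F + b G = 0. *)
pose t := tangent_vec ((1 + fy ^+ 2 - gy ^+ 2) / D)
   (- (fx * fy - gx * gy) / D).
exists (e1 R - t); split=> /=.
  by rewrite opprB addrC subrK; apply/tangent_graphP; do 2!eexists.
move=> _ /tangent_graphP[x [y ->]].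
rewrite minkBl e1E !mink_row4; rewrite /D /det_gram.
field.
by rewrite lt0r_neq0.
Qed.

(** Eliminating b between the two normal equations gives D a = G for the
X-coefficient a of the tangent part; the left-hand side is D (1 - a). *)
Lemma mink_normal_part_graph :
  det_gram R fx fy gx gy *
    mink (normal_part phi (e1 R) p) (normal_part phi (e1 R) p) =
  - ((1 + fy ^+ 2) * gx ^+ 2 - 2 * fx * fy * gx * gy
       - (1 - gy ^+ 2) * fx ^+ 2).
Proof.
have [tan_t nor_w] := normal_part_graph.
rewrite (mink_normal_self _ _ _ _ _ tan_t nor_w).
move: tan_t nor_w; set w := normal_part _ _ _ => /tangent_graphP[a [b t_def]].
have {t_def}-> : w = e1 R - tangent_vec a b by rewrite -t_def opprB addrC subrK.
move=> nor_w.
(* Testing against X = tangent_vec 1 0 and Y = tangent_vec 0 1. *)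
have nor x y : mink (e1 R - tangent_vec a b) (tangent_vec x y) = 0.
  by apply/nor_w/tangent_graphP; do 2!eexists.
pose E := 1 + fx ^+ 2 - gx ^+ 2.
pose F := fx * fy - gx * gy.
pose G := 1 + fy ^+ 2 - gy ^+ 2.
have aE_bF : 1 - (a * E + b * F) = 0.
  by rewrite -(nor 1 0) minkBl e1E !mink_row4 /E /F; ring.
have aF_bG : a * F + b * G = 0.
  by rewrite -oppr0 -(nor 0 1) minkBl e1E !mink_row4 /F /G; ring.
have -> : mink (e1 R) (e1 R - tangent_vec a b) = 1 - a.
  by rewrite minkC minkBl e1E !mink_row4; ring.
transitivity ((E - 1) * G - F ^+ 2
    + G * (1 - (a * E + b * F)) + F * (a * F + b * G)).
  by rewrite /det_gram -/E -/F -/G; ring.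
by rewrite aE_bF aF_bG !mulr0 !addr0 /E /F /G; ring.
Qed.
End GraphAt.

Theorem corollary3p4 (R : realType) (U : set 'rV[R]_2) (f g : 'rV[R]_2 -> R)
    (U_open : open U)
    (f_smooth : smooth_on U f) (g_smooth : smooth_on U g)
    (M_spacelike : spacelike U (graph_param f g))
    (e1_not_tangent : forall p : 'rV[R]_2, U p ->
       ~ tangent_space (graph_param f g) p (e1 R)) :
  canonical_normal_null_direction U (graph_param f g) (e1 R) <->
  (forall p : 'rV[R]_2, U p ->
     let fx := partial 0 f p in let fy := partial 1 f p in
     let gx := partial 0 g p in let gy := partial 1 g p in
     (1 + fy ^+ 2) * gx ^+ 2 - 2 * fx * fy * gx * gy
       - (1 - gy ^+ 2) * fx ^+ 2 = 0).
Proof.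
have f_diff p (Up : U p) : differentiable f p := f_smooth [::] p Up.
have g_diff p (Up : U p) : differentiable g p := g_smooth [::] p Up.
split=> [null p Up /=|pde p Up].
  have [_ ww0] := null p Up.
  have := mink_normal_part_graph _ _ _ _ (f_diff p Up) (g_diff p Up) (M_spacelike p Up).
  by rewrite ww0 mulr0 => /esym/eqP; rewrite oppr_eq0 => /eqP.
split.
  have [tan_t _] :=
    normal_part_graph _ _ _ _ (f_diff p Up) (g_diff p Up) (M_spacelike p Up).
  apply/eqP => w0; apply: (e1_not_tangent p Up).
  by rewrite w0 subr0 in tan_t.
have := mink_normal_part_graph _ _ _ _ (f_diff p Up) (g_diff p Up) (M_spacelike p Up).
have D_gt0 := graph_gram_gt0 _ _ _ _ (f_diff p Up) (g_diff p Up) (M_spacelike p Up).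
have /= -> := pde p Up.
rewrite oppr0 => /eqP; rewrite mulf_eq0 gt_eqF //=.
by move/eqP.
Qed.
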